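(* Let $n\ge 1$, let $N\in\mathfrak{gl}_n(\mathbb{C})$ be the regular nilpotent operator with $Ne_1=0$ and $Ne_{i+1}=e_i$ for $1\le i<n$, let $h$ be any Hessenberg function, and let the one-dimensional torus $S=\{\operatorname{diag}(t,t^2,\dots,t^n):t\in\mathbb{C}^*\}$ act by left multiplication on $\mathrm{GL}_n(\mathbb{C})/B$ and on $\mathrm{Hess}(N,h)$. Then for all $[w]\in(\mathrm{GL}_n(\mathbb{C})/B)^S$ (with $w\in S_n$), $[w]\in\mathrm{Hess}(N,h)^S$ if and only if $w^{-1}(i)\le h(w^{-1}(i+1))$ for all $i$ such that $1\le i<n$.
   Context: $B\subset \mathrm{GL}_n(\mathbb{C})$ is the subgroup of upper triangular matrices, $\mathrm{GL}_n(\mathbb{C})/B$ is the full flag variety, and $[g]=gB$; $e_1,\dots,e_n$ is the standard basis of $\mathbb{C}^n$. For $g\in\mathrm{GL}_n(\mathbb{C})$, $V_j(g)$ is the span of the first $j$ columns of $g$. A Hessenberg function is a map $h:\{1,\dots,n\}\to\{1,\dots,n\}$ with $j\le h(j)$ for all $1\le j\le n$ and $h(j)\le h(j+1)$ for $1\le j\le n-1$. For $X\in\mathfrak{gl}_n(\mathbb{C})$ the Hessenberg variety is $\mathrm{Hess}(X,h)=\{gB\in \mathrm{GL}_n(\mathbb{C})/B : X V_j(g)\subseteq V_{h(j)}(g)\ \text{for all } j\}$. The variety $\mathrm{Hess}(N,h)$ is $S$-invariant. A permutation $w\in S_n$ is identified with the permutation matrix given by $we_i=e_{w(i)}$, and the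 $S$-fixed points of $\mathrm{GL}_n(\mathbb{C})/B$ are exactly the flags $[w]$, $w\in S_n$. A superscript $S$ denotes the fixed point set. *)

(* Defs.v *)
From HB Require Import structures.
From mathcomp Require Import all_boot all_order all_fingroup all_algebra.
From mathcomp Require Import boolp classical_sets reals complex.

Set Implicit Arguments.
Unset Strict Implicit.
Unset Printing Implicit Defensive.

Import GRing.Theory Num.Theory.
Local Open Scope ring_scope.
Local Open Scope classical_set_scope.
Local Open Scope complex_scope.

(* Indices are shifted by one: the index i of {1, ..., n} is the ordinal of
   value i - 1.  A Hessenberg function only compares indices, so its defining
   conditions are unaffected by the shift.  C is R[i], with R a realType. *)

Definition hessenberg_fun (n : nat) (h : 'I_n -> 'I_n) : Prop :=
  (forall j : 'I_n, (j <= h j)%N) /\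
  (forall j k : 'I_n, k = j.+1 :> nat -> (h j <= h k)%N).

Section FlagVariety.
Variables (R : realType) (n : nat).
Local Notation M := 'M[R[i]]_n.

Definition GL : set M := [set g | g \in unitmx].

(* [is_trig_mx] means lower triangular. *)
Definition borel : set M := [set b | GL b /\ is_trig_mx b^T].

Definition coset (g : M) : set M := [set g *m b | b in borel].

Definition flag_variety : set (set M) := [set coset g | g in GL].

(* Here j is a number of columns, not a shifted index. *)
Definition flag_space (j : nat) (g : M) : {vspace 'cV[R[i]]_n} :=
  <<[seq col k g | k : 'I_n <- enum 'I_n & (k < j)%N]>>%VS.

Definition Hess (X : M) (h : 'I_n -> 'I_n) : set (set M) :=
  [set coset g | g in [set g : M | GL g /\
     forall j : 'I_n,
       (linfun (mulmx X) @: flag_space j.+1 g <= flag_space (h j).+1 g)%VS]].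

Definition torus : set M :=
  [set diag_mx (\row_(i < n) t ^+ i.+1) | t in [set t : R[i] | t != 0]].

Definition lact (s : M) (F : set M) : set M := [set s *m x | x in F].

Definition torus_fixed (Y : set (set M)) : set (set M) :=
  [set F | Y F /\ forall s : M, torus s -> lact s F = F].

Definition regular_nilpotent : M :=
  \matrix_(i < n, j < n) (j == i.+1 :> nat)%:R.

(* [perm_mx s] has entries (s i == j), so the matrix sending e_i to e_(w i)
   is [perm_mx w^-1]. *)
Definition perm_flag (w : 'S_n) : set M := coset (perm_mx w^-1%g).

End FlagVariety.

Arguments regular_nilpotent {R n}.
Arguments flag_variety {R n}.
Arguments perm_flag {R n} w.

(* Main.v *)
Require Import Defs.
From HB Require Import structures.
From mathcomp Require Import all_boot all_order all_fingroup all_algebra.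
From mathcomp Require Import boolp classical_sets reals complex.

(** The flag of [w] is spanned by reordered basis vectors: its [j]-th space is
    the span of the [e_(w k)] with [k <= j], so [e_i] lies in it exactly when
    [w^-1 i <= j] ([delta_mem_perm_flag_space]).  Since [N] sends [e_(i+1)] to
    [e_i] and kills [e_1], the Hessenberg conditions say that, whenever
    [w^-1 (i+1) <= j], the index [w^-1 i] is at most [h j].  As [h] is
    nondecreasing, the tightest of these conditions is the one for
    [j = w^-1 (i+1)], which is the inequality of the statement.

    Membership of a coset in the Hessenberg variety only provides some
    representative satisfying the conditions; [flag_space_coset] shows that the
    spaces of a flag, hence the conditions, do not depend on the
    representative.  Torus invariance of the flag of [w] does not depend on
    the variety in which the flag is considered, so it carries over from the
    full flag variety. *)

Set Implicit Arguments.
Unset Strict Implicit.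
Unset Printing Implicit Defensive.

Import GRing.Theory Num.Theory.
Local Open Scope ring_scope.
Local Open Scope classical_set_scope.
Local Open Scope complex_scope.

Lemma hessenberg_fun_homo (n : nat) (h : 'I_n -> 'I_n) :
  hessenberg_fun h -> {homo h : j k / (j <= k)%N}.
Proof.
move=> [_ hS] j [m m_lt_n] /=; elim: m m_lt_n => [|m IHm] m_lt_n.
  rewrite leqn0 => /eqP j0.
  by rewrite (_ : j = Ordinal m_lt_n) //; apply: val_inj.
rewrite leq_eqVlt ltnS => /orP[/eqP jE|j_le_m].
  by rewrite (_ : j = Ordinal m_lt_n) //; apply: val_inj.
have m_lt_n' := ltnW m_lt_n.
exact: leq_trans (IHm m_lt_n' j_le_m) (hS (Ordinal m_lt_n') (Ordinal m_lt_n) erefl).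
Qed.

Section FlagSpaces.
Variables (R : realType) (n : nat).
Local Notation C := R[i].
(* The cosets [g B], as opposed to those of a subgroup of a finite group. *)
Local Notation coset := (@Defs.coset R n).
Implicit Types (g b X : 'M[C]_n) (w : 'S_n) (h : 'I_n -> 'I_n).

Lemma col_mem_flag_space g (j : nat) (k : 'I_n) :
  (k < j)%N -> col k g \in flag_space j g.
Proof.
move=> k_lt_j; apply: memv_span; apply/mapP; exists k => //.
by rewrite mem_filter k_lt_j mem_enum.
Qed.

Lemma flag_space_subvP g (j : nat) (U : {vspace 'cV[C]_n}) :
  (forall k : 'I_n, (k < j)%N -> col k g \in U) <->
  (flag_space j g <= U)%VS.
Proof.
split=> [gU|/subvP gU k k_lt_j]; last exact/gU/col_mem_flag_space.
apply/span_subvP => v /mapP[k]; rewrite mem_filter => /andP[k_lt_j _] ->.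
exact: gU.
Qed.

(** Column [k] of [g *m b] only involves the columns of [g] of index at most
    [k], because [b] is upper triangular. *)
Lemma flag_space_mulmx_sub g b (j : nat) :
  is_trig_mx b^T -> (flag_space j (g *m b) <= flag_space j g)%VS.
Proof.
move=> /is_trig_mxP b_trig; apply/flag_space_subvP => k k_lt_j.
have -> : col k (g *m b) = \sum_i b i k *: col i g.
  apply/colP => i; rewrite summxE !mxE.
  by apply: eq_bigr => l _; rewrite !mxE mulrC.
apply: memv_suml => i _; have [i_le_k|k_lt_i] := leqP i k.
  exact/memvZ/col_mem_flag_space/(leq_ltn_trans i_le_k).
by have := b_trig _ _ k_lt_i; rewrite mxE => ->; rewrite scale0r mem0v.
Qed.

Lemma coset_refl g : coset g g.
Proof.
exists 1%:M; last by rewrite mulmx1.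
split; first exact: unitmx1.
by rewrite trmx1 scalar_mx_is_trig.
Qed.

Lemma flag_space_coset g g' (j : nat) :
  coset g = coset g' -> flag_space j g = flag_space j g'.
Proof.
have sub x y : coset y x -> (flag_space j x <= flag_space j y)%VS.
  by move=> [b [_ b_trig] <-]; apply: flag_space_mulmx_sub.
move=> gg'; apply/eqP; rewrite eqEsubv; apply/andP; split; apply: sub.
  by rewrite -gg'; apply: coset_refl.
by rewrite gg'; apply: coset_refl.
Qed.

(** Since the spaces of a flag are independent of its representative, the
    Hessenberg conditions can be tested on any given one, and on columns. *)
Lemma Hess_cosetP X h g : g \in unitmx ->
  Hess X h (coset g) <->
  (forall j k : 'I_n, (k <= j)%N -> X *m col k g \in flag_space (h j).+1 g).
Proof.
move=> g_unit; split=> [[g' [_ Hg'] gg'] j k k_le_j|Hg].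
  have := Hg' j; rewrite !(flag_space_coset _ gg') => /subvP; apply.
  by rewrite -[X *m _](lfunE (mulmx X)) memv_img ?col_mem_flag_space.
exists g => //; split=> // j; rewrite limg_span.
apply/span_subvP => v /mapP[_ /mapP[k k_in ->] ->]; rewrite lfunE.
by apply: Hg; move: k_in; rewrite mem_filter ltnS => /andP[].
Qed.

Lemma col_perm_mx_inv w (k : 'I_n) :
  col k (perm_mx w^-1) = delta_mx (w k) 0 :> 'cV[C]_n.
Proof.
apply/colP => i; rewrite !mxE eqxx andbT; congr (_%:R).
by rewrite -(inj_eq (@perm_inj _ w)) permKV.
Qed.

Lemma delta_mem_perm_flag_space w (j : nat) (i : 'I_n) :
  ((delta_mx i 0 : 'cV[C]_n) \in flag_space j (perm_mx w^-1)) =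
  ((w^-1)%g i < j)%N.
Proof.
apply/idP/idP => [|i_lt_j]; last first.
  by have := col_mem_flag_space (perm_mx w^-1) i_lt_j;
     rewrite col_perm_mx_inv permKV.
(* Otherwise the i-th coordinate vanishes on all the spanning vectors. *)
apply: contraLR; rewrite -leqNgt => j_le_i; apply/negP => ei_in.
have /flag_space_subvP/subvP/(_ _ ei_in) : forall k : 'I_n, (k < j)%N ->
    col k (perm_mx w^-1) \in lker (linfun (@row C n 1 i)).
  move=> k k_lt_j; rewrite memv_ker lfunE col_perm_mx_inv /=.
  apply/eqP/rowP => l; rewrite !mxE.
  case: eqP => // iE; move: k_lt_j; rewrite ltnNge.
  by rewrite iE permK in j_le_i; rewrite j_le_i.
rewrite memv_ker lfunE /= => /eqP/rowP/(_ 0).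
by rewrite !mxE !eqxx => /eqP; rewrite oner_eq0.
Qed.

Lemma regular_nilpotent_delta (i k : 'I_n) : k = i.+1 :> nat ->
  regular_nilpotent *m delta_mx k 0 = delta_mx i 0 :> 'cV[C]_n.
Proof.
move=> kE; rewrite -colE; apply/colP => l; rewrite !mxE eqxx andbT kE eqSS.
by rewrite eq_sym.
Qed.

Lemma regular_nilpotent_delta0 (k : 'I_n) : k = 0%N :> nat ->
  regular_nilpotent *m delta_mx k 0 = 0 :> 'cV[C]_n.
Proof. by move=> k0; rewrite -colE; apply/colP => l; rewrite !mxE k0. Qed.

Lemma Hess_perm_flagP h w : hessenberg_fun h ->
  Hess regular_nilpotent h (@perm_flag R n w) <->
  (forall i k : 'I_n, k = i.+1 :> nat -> ((w^-1)%g i <= h ((w^-1)%g k))%N).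
Proof.
move=> h_hess.
apply: (iff_trans (Hess_cosetP _ _ (unitmx_perm _ _))).
split=> [Hw i k kE|Hw j k k_le_j].
  have := Hw ((w^-1)%g k) ((w^-1)%g k) (leqnn _).
  by rewrite col_perm_mx_inv permKV (regular_nilpotent_delta kE)
             delta_mem_perm_flag_space.
rewrite col_perm_mx_inv.
case wkE: (nat_of_ord (w k)) => [|i].
  by rewrite regular_nilpotent_delta0 ?mem0v.
have i_lt_n : (i < n)%N by rewrite ltnW // -wkE.
rewrite (@regular_nilpotent_delta (Ordinal i_lt_n)) //.
rewrite delta_mem_perm_flag_space ltnS.
apply: leq_trans (Hw (Ordinal i_lt_n) (w k) wkE) _; rewrite permK.
exact: hessenberg_fun_homo.
Qed.

End FlagSpaces.

Theorem corollary5p1 (R : realType) (n : nat) (n_ge1 : (1 <= n)%N)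
    (h : 'I_n -> 'I_n) (h_hess : hessenberg_fun h) (w : 'S_n)
    (w_fixed : torus_fixed flag_variety (@perm_flag R n w)) :
  torus_fixed (Hess regular_nilpotent h) (@perm_flag R n w) <->
  (forall i k : 'I_n, k = i.+1 :> nat ->
     ((w^-1)%g i <= h ((w^-1)%g k))%N).
Proof.
have [_ w_inv] := w_fixed; split=> [[/(Hess_perm_flagP R w h_hess)]//|Hw].
by split=> //; apply/(Hess_perm_flagP R w h_hess).
Qed.
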